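(* Let $k\in\mathbb N$ and fix $\eta>0$. Then there exists a missing-digit fractal $\mathcal K\subseteq[0,1]^k$ with $\mathcal K\supseteq[0,1]^{k-1}\times\{0\}$ such that \[ \#\mathcal N_{\mathcal K}(Q,0)\ll Q^{k+\eta}\quad(Q\geqslant1)\qquad\text{and}\qquad \dim_{\mathrm H}(\mathcal K)>k-\eta. \]
   Context: A missing-digit fractal is a set $\mathcal K_{b,\mathcal D}=\{\sum_{j\geqslant1}\mathbf d^{(j)}b^{-j}:\mathbf d^{(j)}\in\mathcal D\}\subseteq[0,1]^k$ with integers $b\geqslant2$ and nonempty $\mathcal D\subseteq\{0,1,\dots,b-1\}^k$. $\dim_{\mathrm H}$ is Hausdorff dimension. $\mathcal N_{\mathcal K}(Q,0)=\{(\mathbf a,q)\in\mathbb Z^k\times(\mathbb Z\cap[1,Q]):\ \mathbf a/q\in\mathcal K\}$. *)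

(* Defs.v *)
From HB Require Import structures.
From mathcomp Require Import all_boot all_order all_algebra.
From mathcomp Require Import all_classical all_reals all_analysis.
Set Implicit Arguments. Unset Strict Implicit. Unset Printing Implicit Defensive.
Import Order.TTheory GRing.Theory Num.Theory.
Import numFieldNormedType.Exports.
Local Open Scope classical_set_scope.
Local Open Scope ring_scope.

Definition edist (R : realType) (k : nat) (x y : 'I_k -> R) : R :=
  Num.sqrt (\sum_(i < k) (x i - y i) ^+ 2).

(* diameter (in \bar R; +oo for unbounded sets, -oo for the empty set) *)
Definition diam (R : realType) (k : nat) (U : set ('I_k -> R)) : \bar R :=
  ereal_sup [set (edist x y)%:E | x in U & y in U].

Definition cover_cost (R : realType) (k : nat) (s : R) (U : set ('I_k -> R)) : \bar R :=
  if pselect (U = set0) then 0%E else ((fine (diam U)) `^ s)%:E.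

Definition hausdorff_delta (R : realType) (k : nat) (s delta : R)
    (A : set ('I_k -> R)) : \bar R :=
  ereal_inf [set (\sum_(0 <= i <oo) cover_cost s (F i))%E |
     F in [set F : nat -> set ('I_k -> R) |
        A `<=` \bigcup_i F i /\ forall i, (diam (F i) <= delta%:E)%E]].

Definition hausdorff_measure (R : realType) (k : nat) (s : R)
    (A : set ('I_k -> R)) : \bar R :=
  ereal_sup [set hausdorff_delta s delta A | delta in [set d : R | 0 < d]].

Definition hausdorff_dim (R : realType) (k : nat) (A : set ('I_k -> R)) : \bar R :=
  ereal_inf [set s%:E | s in [set s : R | 0 <= s /\ hausdorff_measure s A = 0%E]].

(* K_{b,D} = { sum_{j>=1} d^(j) b^-j : d^(j) in D } ; digit vectors d^(j)
   in {0..b-1}^k are finite functions 'I_k -> 'I_b; the digit sequence is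
   indexed from 0, i.e. d j = d^(j+1). *)
Definition missing_digit_set (R : realType) (k b : nat)
    (D : {set {ffun 'I_k -> 'I_b}}) : set ('I_k -> R) :=
  [set x | exists d : nat -> {ffun 'I_k -> 'I_b},
     (forall j, d j \in D) /\
     forall i : 'I_k,
       (fun n => \sum_(0 <= j < n) ((nat_of_ord (d j i))%:R / (b%:R ^+ j.+1) : R))
         @ \oo --> x i].

Definition is_missing_digit_fractal (R : realType) (k : nat) (K : set ('I_k -> R)) :=
  exists (b : nat) (D : {set {ffun 'I_k -> 'I_b}}),
    (2 <= b)%N /\ D != finset.set0 /\ K = @missing_digit_set R k b D.

Definition face0 (R : realType) (k : nat) : set ('I_k -> R) :=
  [set x | forall i : 'I_k,
     if (nat_of_ord i == k.-1)%N then x i = 0 else 0 <= x i <= 1].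

Definition rat_points (R : realType) (k : nat) (K : set ('I_k -> R)) (Q : R)
    : set ({ffun 'I_k -> int} * int) :=
  [set p : {ffun 'I_k -> int} * int | (1 <= p.2)%R /\ (p.2%:~R <= Q) /\
           K (fun i => (p.1 i)%:~R / p.2%:~R)].

Definition count_rat_points (R : realType) (k : nat) (K : set ('I_k -> R)) (Q : R)
    : \bar R :=
  (\esum_(p in rat_points K Q) 1)%E.

(* Main.v *)
Require Import Defs.
From HB Require Import structures.
From mathcomp Require Import all_boot all_order all_algebra zify ring lra.
From mathcomp Require Import all_classical all_reals all_analysis.
Set Implicit Arguments. Unset Strict Implicit. Unset Printing Implicit Defensive.
Import Order.TTheory GRing.Theory Num.Theory.
Import numFieldNormedType.Exports.
Local Open Scope classical_set_scope.
Local Open Scope ring_scope.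

(** The fractal is [0,1]^(k-1) x C, where C is the set of reals whose digits in
    base b = (8H)^m are all less than N = b / (8H); here H = 4^t, and m and t
    are large in terms of eta.

    Counting.  If x is in C, every b^j x lies within 1/(8H) above an integer,
    so e(h b^j x) has real part at least 1/2 for all h < H.  Let S_J be the set
    of the H^J integers \sum_(j < J) h_j b^j with h_j < H.  The exponential sum
    of S_J at x factors over j, so its squared modulus is at least (H/2)^(2J).
    Summed over all a/q with a mod q, this squared modulus is q times the number
    of pairs in S_J congruent mod q.  Summing over q <= n, the diagonal pairs
    contribute n^2 H^J and the others n H^(2J) times a divisor function, so C has
    at most 4^J n (n H^-J + n^o(1)) fractions of denominator at most n.  Taking
    H^J about n makes 4^J about n^(1/t).

    Dimension.  Reading base-#|D| digits as elements of D maps [0,1) into K, and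
    the preimage of a set of diameter at most b^-n is covered by 5^k intervals of
    length #|D|^-n.  Lebesgue measure then bounds the cost of any cover below. *)

(** * The divisor function grows slower than any power *)

Lemma size_divisors n :
  size (divisors n) = (\prod_(f <- prime_decomp n) f.2.+1)%N.
Proof.
rewrite /divisors; elim: (prime_decomp n) => [|f s IHs]; first by rewrite big_nil.
rewrite big_cons -IHs /=; case: f => p e /=.
elim: e => [|e IHe] /=; first by rewrite mul1n.
by rewrite size_merge size_cat size_map IHe [in RHS]mulSn addnC.
Qed.

(** With [f = j %/ e], one has [j + 1 <= e (f + 1) <= e 2^f]; raising to the power [e] gives the
    claim. It handles the small primes in the divisor bound. *)
Lemma leq_expS_exp2 e j : (0 < e)%N -> (j.+1 ^ e <= e ^ e * 2 ^ j)%N.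
Proof.
move=> e0; have jle : (j.+1 <= e * 2 ^ (j %/ e))%N.
  rewrite (leq_trans (n := (e * (j %/ e).+1)%N)) //.
    by rewrite mulnC ltn_ceil.
  by rewrite leq_mul2l ltn_expl // orbT.
rewrite (leq_trans (n := ((e * 2 ^ (j %/ e)) ^ e)%N)) ?leq_exp2r //.
by rewrite expnMn leq_mul2l -expnM leq_pexp2l ?orbT // leq_trunc_div.
Qed.

(** A prime power [p^j] contributes [(j+1)^e]. If [p >= 2^e] this is at most [2^(j e) <= p^j]; each
    smaller prime costs an extra factor [e^e], and there are at most [2^e] of them. Taking [e]-th
    powers keeps the estimate in the naturals. *)
Lemma divisor_bound e n : (0 < e)%N -> (0 < n)%N ->
  (size (divisors n) ^ e <= (e ^ e) ^ (2 ^ e) * n)%N.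
Proof.
move=> e0 n0; rewrite size_divisors.
pose small (f : nat * nat) := (f.1 < 2 ^ e)%N.
have smallP : (\prod_(f <- prime_decomp n | small f) e ^ e <= (e ^ e) ^ (2 ^ e))%N.
  rewrite big_const_seq iter_muln_1 leq_pexp2l ?expn_gt0 ?e0 //.
  have -> : count small (prime_decomp n) = count (fun p => p < 2 ^ e)%N (primes n).
    by rewrite /primes count_map.
  rewrite -size_filter -[X in (_ <= X)%N](size_iota 0) uniq_leq_size //.
    by rewrite filter_uniq // primes_uniq.
  by move=> p; rewrite mem_filter mem_iota => /andP[].
rewrite [X in (_ <= _ * X)%N](prod_prime_decomp n0).
apply: leq_trans (leq_mul smallP (leqnn _)).
rewrite [X in (_ <= X * _)%N]big_mkcond -big_split /=.
rewrite (big_morph (fun x => x ^ e)%N (id1 := 1%N) (op1 := muln)); last 2 first.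
- by move=> x y; rewrite expnMn.
- by rewrite exp1n.
rewrite big_seq [X in (_ <= X)%N]big_seq.
apply: leq_prod => -[p j] /mem_prime_decomp[pr_p j0 _] /=.
rewrite /small /=; case: ltnP => [_|lep].
  apply: leq_trans (leq_expS_exp2 _ e0) _.
  by rewrite leq_mul2l leq_exp2r // prime_gt1 // orbT.
rewrite mul1n; apply: leq_trans (_ : (2 ^ j) ^ e <= _)%N.
  by rewrite leq_exp2r // ltn_expl.
by rewrite -expnM mulnC expnM leq_exp2r.
Qed.

(** * The frequency sets S_J, listed without repetition *)

Fixpoint digit_sums (b H J : nat) : seq nat :=
  if J is J'.+1
  then [seq (x + b ^ J' * h)%N | x <- digit_sums b H J', h <- iota 0 H]
  else [:: 0%N].

Lemma size_digit_sums b H J : size (digit_sums b H J) = (H ^ J)%N.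
Proof. by elim: J => //= J IH; rewrite size_allpairs IH size_iota -expnSr. Qed.

Lemma digit_sums_lt b H J x : (H <= b)%N -> x \in digit_sums b H J -> (x < b ^ J)%N.
Proof.
move=> Hb; elim: J x => [|J IH] x /=; first by rewrite inE => /eqP ->.
move=> /allpairsP[[y h] /= [/IH ylt]]; rewrite mem_iota add0n => /andP[_ hH] ->.
have hb := leq_trans hH Hb.
by rewrite expnSr (leq_trans (n := (b ^ J * h.+1)%N)) ?leq_mul2l ?hb ?orbT //
  mulnS -addSn leq_add2r.
Qed.

Lemma digit_sums_uniq b H J : (H <= b)%N -> uniq (digit_sums b H J).
Proof.
move=> Hb; elim: J => //= J IH; apply: allpairs_uniq; rewrite ?iota_uniq //.
move=> _ _ /allpairsP[[x h] /= [xs _ ->]] /allpairsP[[y g] /= [ys _ ->]].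
move=> /= e; have xl := digit_sums_lt Hb xs; have yl := digit_sums_lt Hb ys.
have b0 : (0 < b ^ J)%N by apply: leq_ltn_trans xl.
have eh : h = g.
  have /= := congr1 (fun z => z %/ (b ^ J))%N e.
  by rewrite ![(_ + b ^ J * _)%N]addnC ![(b ^ J * _)%N]mulnC !divnMDl // !divn_small // !addn0.
by move: e; rewrite eh => /addIn ->.
Qed.

(** * Exponential sums over S_J and fractions with a fixed denominator *)

Section Fourier.
Variable R : realType.
Implicit Types (x y : R) (s : seq nat).

Definition cos_sum s x : R := \sum_(n <- s) cos (pi *+ 2 * n%:R * x).
Definition sin_sum s x : R := \sum_(n <- s) sin (pi *+ 2 * n%:R * x).
(** Squared modulus of the sum of [e(n x)] over [n] in [s], where [e(t) = exp(2 pi i t)], written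
    with real and imaginary parts. *)
Definition exp_sum_sq s x : R := cos_sum s x ^+ 2 + sin_sum s x ^+ 2.

Lemma exp_sum_sq_ge0 s x : 0 <= exp_sum_sq s x.
Proof. by rewrite addr_ge0 ?sqr_ge0. Qed.

(** Since [e((n + b^J h) x) = e(n x) e(h b^J x)], the sum factors and squared moduli multiply; [Ec]
    and [Es] are this complex product in coordinates. *)
Lemma exp_sum_sq_digit_sumsS b H J x :
  exp_sum_sq (digit_sums b H J.+1) x =
  exp_sum_sq (digit_sums b H J) x * exp_sum_sq (iota 0 H) (b%:R ^+ J * x).
Proof.
set y := b%:R ^+ J * x.
have splitang n h : pi *+ 2 * (n + b ^ J * h)%:R * x =
    pi *+ 2 * n%:R * x + pi *+ 2 * h%:R * y.
  by rewrite natrD natrM natrX /y; ring.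
have Ec : cos_sum (digit_sums b H J.+1) x =
    cos_sum (digit_sums b H J) x * cos_sum (iota 0 H) y -
    sin_sum (digit_sums b H J) x * sin_sum (iota 0 H) y.
  rewrite /cos_sum /sin_sum /= big_allpairs_dep !big_distrl /= -sumrB.
  apply: eq_bigr => n _; rewrite !big_distrr /= -sumrB.
  by apply: eq_bigr => h _; rewrite splitang cosD.
have Es : sin_sum (digit_sums b H J.+1) x =
    sin_sum (digit_sums b H J) x * cos_sum (iota 0 H) y +
    cos_sum (digit_sums b H J) x * sin_sum (iota 0 H) y.
  rewrite /cos_sum /sin_sum /= big_allpairs_dep !big_distrl /= -big_split.
  apply: eq_bigr => n _; rewrite /= !big_distrr /= -big_split.
  by apply: eq_bigr => h _; rewrite splitang sinD.
by rewrite /exp_sum_sq Ec Es; ring.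
Qed.

Lemma cosDnat2pi (y : R) (n : nat) : cos (y + pi *+ 2 * n%:R) = cos y.
Proof. by rewrite mulr_natr (periodicn (@cosD2pi R)). Qed.

Lemma sinDnat2pi (y : R) (n : nat) : sin (y + pi *+ 2 * n%:R) = sin y.
Proof. by rewrite mulr_natr (periodicn (@sinD2pi R)). Qed.

(** Nonnegativity of [cos (2 y)] gives [cos y ^ 2 >= 1/2], and [cos y >= cos y ^ 2] because [cos y]
    lies in [0,1]. *)
Lemma cos_ge_half (y : R) : 0 <= y <= pi / 4 -> 2^-1 <= cos y.
Proof.
move=> /andP[y0 y4]; have pi0 := @pi_ge0 R.
have c0 : 0 <= cos y by apply: cos_ge0_pihalf; apply/andP; split; lra.
have : 0 <= cos (y *+ 2) by apply: cos_ge0_pihalf; rewrite -mulr_natr; apply/andP; split; lra.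
rewrite cos_mulr2n -mulr_natr; have := cos_le1 y; nra.
Qed.

(** The constant 8 is chosen so that an excess [t <= 1/(8H)] over an integer gives angles
    [2 pi h t <= pi/4] for all [h < H]. *)
Definition narrow (b H : nat) x :=
  forall j, exists z : nat, z%:R <= b%:R ^+ j * x <= z%:R + (8 * H%:R)^-1.

Lemma exp_sum_sq_narrow b H J x : narrow b H x ->
  (H%:R / 2) ^+ (2 * J) <= exp_sum_sq (digit_sums b H J) x.
Proof.
move=> nx; elim: J => [|J IH].
  rewrite muln0 expr0 /exp_sum_sq /cos_sum /sin_sum /= !big_seq1.
  by rewrite mulr0 mul0r cos0 sin0; lra.
rewrite exp_sum_sq_digit_sumsS mulnS addnC exprD.
apply: ler_pM => //; rewrite ?exprn_ge0 ?divr_ge0 //.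
rewrite /exp_sum_sq -[leLHS]addr0; apply: lerD; last exact: sqr_ge0.
suff le_c : H%:R / 2 <= cos_sum (iota 0 H) (b%:R ^+ J * x).
  by rewrite ler_sqr ?nnegrE ?divr_ge0 // (le_trans _ le_c) ?divr_ge0.
have [z /andP[z1 z2]] := nx J.
have -> : H%:R / 2 = \sum_(h <- iota 0 H) (2^-1 : R).
  by rewrite big_const_seq count_predT size_iota iter_addr_0 mulr_natl.
rewrite /cos_sum big_seq [leRHS]big_seq; apply: ler_sum => h.
rewrite mem_iota add0n => /andP[_ hH].
set t := b%:R ^+ J * x - z%:R.
(* The integer part [z] only contributes full turns. *)
have -> : pi *+ 2 * h%:R * (b%:R ^+ J * x) =
    pi *+ 2 * h%:R * t + pi *+ 2 * (h * z)%:R by rewrite /t natrM; ring.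
rewrite cosDnat2pi; apply: cos_ge_half.
have pi0 := @pi_ge0 R; have t0 : 0 <= t by rewrite /t subr_ge0.
apply/andP; split; first by rewrite mulr_ge0 // mulr_ge0 // mulrn_wge0.
have H0 : 0 < H%:R :> R by rewrite ltr0n (leq_ltn_trans _ hH).
have ht : h%:R * t <= 8^-1.
  have -> : 8^-1 = H%:R * (8 * H%:R)^-1 :> R by field; rewrite gt_eqF.
  apply: ler_pM => //; first by rewrite ler_nat ltnW.
  by rewrite /t; lra.
have -> : pi *+ 2 * h%:R * t = pi * (2 * (h%:R * t)) by ring.
by apply: ler_wpM2l => //; lra.
Qed.

Lemma cos_lt1 (y : R) : 0 < y < pi *+ 2 -> cos y < 1.
Proof.
move=> /andP[y0 y2]; have -> : y = (y / 2) *+ 2 by rewrite -mulr_natr; lra.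
have s0 : 0 < sin (y / 2).
  by apply: sin_gt0_pi; move: y2; rewrite -mulr_natr => y2; apply/andP; split; lra.
rewrite cos_mulr2n cos2sin2 -mulr_natr; nra.
Qed.

(** Orthogonality of the additive characters modulo [q]: when [q] does not divide [n], the sum is
    invariant under multiplication by [e(n/q)], which is not 1, so it vanishes. *)
Lemma sum_cos_roots_of_unity (q n : nat) : (0 < q)%N ->
  \sum_(a < q) cos (pi *+ 2 * n%:R * (a%:R / q%:R)) =
  if (q %| n)%N then q%:R else 0 :> R.
Proof.
move=> q0; have q0' : q%:R != 0 :> R by rewrite pnatr_eq0 -lt0n.
case: ifPn => [/dvdnP[m ->]|ndvd].
  rewrite (eq_bigr (fun=> 1)) ?sumr_const ?card_ord // => a _.
  have -> : pi *+ 2 * (m * q)%:R * (a%:R / q%:R) = 0 + pi *+ 2 * (m * a)%:R :> R.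
    by rewrite !natrM add0r; field.
  by rewrite cosDnat2pi cos0.
pose th : R := pi *+ 2 * n%:R / q%:R.
have ang (a : nat) : pi *+ 2 * n%:R * (a%:R / q%:R) = a%:R * th by rewrite /th; ring.
under eq_bigr do rewrite ang.
pose C : R := \sum_(a < q) cos (a%:R * th).
pose S : R := \sum_(a < q) sin (a%:R * th).
have thq : q%:R * th = 0 + pi *+ 2 * n%:R by rewrite /th; field.
have angS (a : nat) : a.+1%:R * th = a%:R * th + th by rewrite -natr1; ring.
(* Multiplying by [e^(i th)] permutes the terms of the sum cyclically. *)
have rotC : C = C * cos th - S * sin th.
  rewrite /C /S !big_distrl /= -sumrB.
  transitivity (\sum_(a < q) cos (a.+1%:R * th)).
    case: q q0 {q0' ang C S ndvd} @th thq angS => // q _ th thq angS.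
    rewrite big_ord_recl big_ord_recr /= thq cosDnat2pi cos0 mul0r cos0 addrC.
    by congr (_ + _).
  by apply: eq_bigr => a _; rewrite angS cosD.
have rotS : S = S * cos th + C * sin th.
  rewrite /C /S !big_distrl /= -big_split.
  transitivity (\sum_(a < q) sin (a.+1%:R * th)).
    case: q q0 {q0' ang C S ndvd rotC} @th thq angS => // q _ th thq angS.
    rewrite big_ord_recl big_ord_recr /= thq sinDnat2pi sin0 mul0r sin0 addrC.
    by congr (_ + _).
  by apply: eq_bigr => a _; rewrite angS sinD.
(* Modulo full turns [th] is [2 pi (n mod q) / q], strictly between 0 and [2 pi]. *)
have th1 : cos th < 1.
  have -> : th = pi *+ 2 * ((n %% q)%:R / q%:R) + pi *+ 2 * (n %/ q)%:R.
    by rewrite /th {1}(divn_eq n q) natrD natrM; field.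
  rewrite cosDnat2pi; apply: cos_lt1.
  have pi0 : 0 < pi *+ 2 :> R by rewrite pmulrn_lgt0 // pi_gt0.
  have qgt0 : 0 < q%:R :> R by rewrite ltr0n.
  rewrite mulr_gt0 //= ?divr_gt0 // ?ltr0n ?lt0n -?[_ %% _ != _]/(_ %| _) //.
  by rewrite gtr_pMr // ltr_pdivrMr // mul1r ltr_nat ltn_mod.
(* Weight [rotC] by [C] and [rotS] by [S] and add: the sine terms cancel. *)
have : (C ^+ 2 + S ^+ 2) * (1 - cos th) = 0.
  transitivity (C * (C - C * cos th) + S * (S - S * cos th)); first by ring.
  have -> : C - C * cos th = - (S * sin th) by lra.
  have -> : S - S * cos th = C * sin th by lra.
  by ring.
move=> /eqP; rewrite mulf_eq0 subr_eq0 [1 == _]gt_eqF // orbF.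
by rewrite paddr_eq0 ?sqr_ge0 // sqrf_eq0 => /andP[/eqP].
Qed.

Definition natdist (m n : nat) : nat := (m - n) + (n - m).

Lemma exp_sum_sqE s x :
  exp_sum_sq s x = \sum_(m <- s) \sum_(n <- s) cos (pi *+ 2 * (natdist m n)%:R * x).
Proof.
rewrite /exp_sum_sq /cos_sum /sin_sum !expr2 !big_distrl -big_split /=.
apply: eq_bigr => m _; rewrite !big_distrr -big_split /=.
apply: eq_bigr => n _; rewrite -cosB /natdist.
have [le_mn|/ltnW le_nm] := leqP m n.
  rewrite -cosN (eqP le_mn) add0n natrB //; congr cos; ring.
by rewrite (eqP le_nm) addn0 natrB //; congr cos; ring.
Qed.

(** Parseval modulo [q]: after expanding the square, orthogonality keeps exactly the pairs congruent
    modulo [q]. *)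
Lemma sum_exp_sum_sq (q : nat) s : (0 < q)%N ->
  \sum_(a < q) exp_sum_sq s (a%:R / q%:R) =
  (q * \sum_(m <- s) \sum_(n <- s) (q %| natdist m n))%:R.
Proof.
move=> q0; rewrite (eq_bigr _ (fun a _ => exp_sum_sqE s _)).
rewrite exchange_big natrM natr_sum mulr_sumr; apply: eq_bigr => m _.
rewrite exchange_big natr_sum mulr_sumr; apply: eq_bigr => n _.
by rewrite sum_cos_roots_of_unity //; case: (q %| _)%N; rewrite ?mulr1 ?mulr0.
Qed.

Definition narrow_fractions (b H q : nat) : {set 'I_q} :=
  [set a : 'I_q | `[< narrow b H (a%:R / q%:R : R) >]].

(** By positivity, only the narrow [a] need be kept in the Parseval identity, each contributing at
    least [(H/2)^(2J)]; the factor [4^J] clears the powers of 2. *)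
Lemma card_narrow_fractions b H J q : (0 < q)%N ->
  (H ^ (2 * J) * #|narrow_fractions b H q| <=
   4 ^ J * (q * \sum_(m <- digit_sums b H J) \sum_(n <- digit_sums b H J)
     (q %| natdist m n)))%N.
Proof.
move=> q0; rewrite -(ler_nat R) natrM [leRHS]natrM -sum_exp_sum_sq //.
have -> : (H ^ (2 * J))%:R = (4 ^ J)%:R * (H%:R / 2) ^+ (2 * J) :> R.
  rewrite !natrX !exprM -exprMn; congr (_ ^+ _); by field.
rewrite -mulrA ler_wpM2l //.
rewrite -sum1_card natr_sum mulr_sumr.
rewrite [leRHS](bigID (mem (narrow_fractions b H q))) /= -[leLHS]addr0.
apply: lerD; last by apply: sumr_ge0 => a _; exact: exp_sum_sq_ge0.
apply: ler_sum => a; rewrite inE => /asboolP na.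
by rewrite mulr1; exact: exp_sum_sq_narrow.
Qed.

End Fourier.

(** * Summation over denominators *)

Lemma sum_dvdn_le n z : (0 < z)%N ->
  (\sum_(1 <= q < n.+1) (q %| z) <= size (divisors z))%N.
Proof.
move=> z0; rewrite -(big_mkcond (fun q => q %| z)%N (fun=> 1%N)) /=.
rewrite sum1_count -size_filter uniq_leq_size ?filter_uniq ?iota_uniq //.
by move=> q; rewrite mem_filter -dvdn_divisors // => /andP[].
Qed.

(** For fixed [x] in S_J, the diagonal [y = x] is counted by all [n] moduli, and any other [y] by at
    most [D], as the difference is nonzero and below [b^J]. This gives [n + H^J D] per [x], and
    [n < H^J] absorbs the first term into [D + 1]. *)
Lemma sum_card_narrow_fractions (R : realType) b H J n D : (H <= b)%N ->
  (n < H ^ J)%N ->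
  (forall z, (0 < z < b ^ J)%N -> (size (divisors z) <= D)%N) ->
  (\sum_(1 <= q < n.+1) #|narrow_fractions R b H q| <= 4 ^ J * n * D.+1)%N.
Proof.
move=> Hb nH HD.
have HJ0 : (0 < H ^ J)%N by apply: leq_ltn_trans nH.
rewrite -(leq_pmul2l (m := H ^ (2 * J))); last by rewrite mulnC expnM expn_gt0 HJ0.
rewrite big_distrr /=.
set s := digit_sums b H J.
have step q : (1 <= q < n.+1)%N -> (H ^ (2 * J) * #|narrow_fractions R b H q| <=
    4 ^ J * n * \sum_(x <- s) \sum_(y <- s) (q %| natdist x y))%N.
  move=> /andP[q0 qn]; apply: leq_trans (card_narrow_fractions R b H J q0) _.
  by rewrite mulnA leq_mul2r leq_mul2l -ltnS qn !orbT.
rewrite big_nat; apply: leq_trans (leq_sum _ step) _; rewrite -big_nat.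
rewrite -big_distrr /= mulnCA leq_mul2l; apply/orP; right.
rewrite exchange_big /=.
have sumy x : x \in s ->
    (\sum_(1 <= q < n.+1) \sum_(y <- s) (q %| natdist x y) <= n + H ^ J * D)%N.
  move=> xs; rewrite exchange_big /=.
  apply: leq_trans (_ : \sum_(y <- s) ((x == y) * n + D) <= _)%N.
    rewrite big_seq [X in (_ <= X)%N]big_seq; apply: leq_sum => y ys.
    have [<-|xy] := eqVneq x y.
      apply: leq_trans (_ : \sum_(1 <= q < n.+1) 1 <= _)%N.
        by apply: leq_sum => q _; exact: leq_b1.
      by rewrite sum_nat_const_nat mul1n; lia.
    apply: leq_trans (sum_dvdn_le _ _) _; first by rewrite /natdist; move/eqP: xy; lia.
    rewrite mul0n add0n; apply: HD; have := digit_sums_lt Hb xs.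
    by have := digit_sums_lt Hb ys; rewrite /natdist; move/eqP: xy; lia.
  rewrite big_split /= -big_distrl /= big_const_seq count_predT iter_addn_0.
  rewrite size_digit_sums (mulnC D) leq_add2r.
  have -> : (\sum_(y <- s) (x == y) = count_mem x s)%N.
    by rewrite -sum1_count [RHS]big_mkcond; apply: eq_bigr => y _; rewrite eq_sym.
  by rewrite count_uniq_mem ?digit_sums_uniq // xs mul1n.
rewrite big_seq; apply: leq_trans (leq_sum _ sumy) _.
rewrite -big_seq big_const_seq count_predT iter_addn_0 size_digit_sums.
rewrite mul2n -addnn expnD.
move: (H ^ J)%N nH HJ0 => h nh h0; rewrite mulnS mulnDl leq_add //.
  by rewrite leq_mul2r ltnW // orbT.
by rewrite -!mulnA leq_mul2l mulnC leqnn orbT.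
Qed.

(** In the [t]-th power of the bound [4^J n (D + 1)], the choice [H = 4^t] turns [4^(J t)] into
    [H^J <= H n], while [(D + 1)^t] is also O(n); the total is O(n^(t+2)). *)
Lemma sum_card_narrow_fractions_pow (R : realType) (t m : nat) :
  (1 < t)%N -> (0 < m)%N ->
  exists C : nat, forall n, (0 < n)%N ->
  ((\sum_(1 <= q < n.+1) #|narrow_fractions R ((8 * 4 ^ t) ^ m) (4 ^ t) q|) ^ t
    <= C * n ^ (t + 2))%N.
Proof.
move=> t1 m0; set H := (4 ^ t)%N; set b := ((8 * H) ^ m)%N.
have t0 : (0 < t)%N by apply: ltnW.
have H8 : (8 <= H)%N.
  by apply: (@leq_trans (4 ^ 2)) => //; rewrite /H leq_exp2l.
have Hb : (H <= b)%N.
  rewrite (leq_trans (n := ((8 * H) ^ 1)%N)) //; first by rewrite expn1; lia.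
  by rewrite leq_pexp2l //; lia.
(* As [b^J <= (H n)^(2m)], the divisor bound with exponent [2 m t] gives [D^t <= A H n] after
   removing the power [2m]. *)
pose e := (2 * m * t)%N; pose A := ((e ^ e) ^ (2 ^ e))%N.
have e0 : (0 < e)%N by rewrite !muln_gt0 m0 t0.
have A0 : (0 < A)%N by rewrite !expn_gt0 e0.
exists (2 ^ t * A * H ^ 2)%N => n n0.
have [J [HJ1 HJ2]] : exists J, (H ^ J <= H * n)%N /\ (n < H ^ J)%N.
  have H1 : (1 < H)%N by apply: leq_trans H8.
  exists (trunc_log H n).+1; have /andP[lo hi] := trunc_log_bounds H1 n0.
  by split; rewrite // expnS leq_mul2l lo orbT.
have bJ : (b ^ J <= (H * n) ^ (2 * m))%N.
  apply: leq_trans (_ : (H ^ J) ^ (2 * m) <= _)%N; last by rewrite leq_exp2r ?muln_gt0 ?m0.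
  rewrite -expnM [(J * _)%N]mulnC expnM leq_exp2r; last first.
    by case: J HJ1 HJ2 => // _; rewrite expn0 ltnS leqNgt n0.
  (* Here [8 <= H] is used, in the form [8 H <= H^2]. *)
  rewrite expnM /b leq_exp2r // -mulnn leq_mul2r H8 orbT //.
pose D := \max_(z < b ^ J | (0 < z)%N) size (divisors z).
have DB : (D ^ t <= A * (H * n))%N.
  rewrite /D; apply: (big_ind (fun D => D ^ t <= A * (H * n))%N).
  - by rewrite exp0n.
  - by move=> x y hx hy; rewrite /maxn; case: ifP.
  move=> z z0; rewrite -(@leq_exp2r _ _ (2 * m)) ?muln_gt0 ?m0 // -expnM.
  rewrite (mulnC t) -/e; apply: leq_trans (divisor_bound e0 z0) _.
  rewrite -/A expnMn leq_mul //; first by rewrite -[leqLHS]expn1 leq_pexp2l // muln_gt0 m0.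
  by apply: leq_trans (ltnW (ltn_ord z)) bJ.
have HD z : (0 < z < b ^ J)%N -> (size (divisors z) <= D)%N.
  move=> /andP[z0 zb]; exact: (@leq_bigmax_cond _ _ (fun z : 'I_(b ^ J) => size (divisors z)) (Ordinal zb)).
have := sum_card_narrow_fractions R Hb HJ2 HD; rewrite -(leq_exp2r _ _ t0) => le1.
apply: leq_trans le1 _; rewrite !expnMn -[((4 ^ J) ^ t)%N]expnM mulnC.
rewrite (mulnC J) [(4 ^ _)%N]expnM -/H.
have D2 : (D.+1 ^ t <= 2 ^ t * (A * (H * n)))%N.
  apply: leq_trans (_ : (2 * maxn 1 D) ^ t <= _)%N; first by rewrite leq_exp2r //; lia.
  rewrite expnMn leq_mul2l /maxn; case: ifP => _; rewrite ?DB ?orbT // exp1n.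
  by rewrite !muln_gt0 A0 n0 (leq_trans _ H8) // orbT.
apply: leq_trans (leq_mul D2 (leq_mul HJ1 (leqnn _))) _.
by rewrite expnD -!mulnn; apply/eq_leq; lia.
Qed.

(** * Base-b expansions and their integer prefixes *)

Fixpoint digit_prefix (b : nat) (d : nat -> nat) (n : nat) : nat :=
  if n is n'.+1 then (b * digit_prefix b d n' + d n')%N else 0%N.

Section Digits.
Variables (R : realType) (b : nat).
Hypothesis b1 : (1 < b)%N.
Implicit Types (d : nat -> nat) (x y : R).

Local Notation digit_series d :=
  (fun n => \sum_(0 <= j < n) ((d j)%:R / b%:R ^+ j.+1 : R)).

Let b0 : 0 < b%:R :> R. Proof. by rewrite ltr0n ltnW. Qed.
Let bX0 n : 0 < b%:R ^+ n :> R. Proof. by rewrite exprn_gt0. Qed.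
Let bXn0 n : b%:R ^+ n != 0 :> R. Proof. by rewrite gt_eqF. Qed.

Lemma digit_seriesE d n : digit_series d n = (digit_prefix b d n)%:R / b%:R ^+ n.
Proof.
elim: n => [|n IH]; first by rewrite big_geq // mul0r.
rewrite big_nat_recr //= IH natrD natrM exprS.
by field; rewrite bXn0 gt_eqF.
Qed.

(** Scaled by [b^n], a tail of digits at most [B] sums to at most [B/(b-1)]. Taking [B = b-1] gives
    an error of 1, while a small [B] gives narrowness. *)
Lemma digit_prefix_bounds (B : nat) d x n : (forall j, d j <= B)%N ->
  digit_series d @ \oo --> x ->
  (digit_prefix b d n)%:R <= b%:R ^+ n * x <= (digit_prefix b d n)%:R + B%:R / (b%:R - 1).
Proof.
move=> dB dx.
have cvgd : cvgn (digit_series d) by apply/cvg_ex; exists x.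
have limE : limn (digit_series d) = x by apply: cvg_lim.
have bm1 : 0 < b%:R - 1 :> R by rewrite subr_gt0 ltr1n.
(* [T m] completes the partial sum with all remaining digits equal to [B]; it decreases, while the
   partial sums increase, so the limit is trapped. *)
pose T m : R := digit_series d m + B%:R / (b%:R - 1) / b%:R ^+ m.
have TS m : T m.+1 <= T m.
  rewrite /T big_nat_recr //= -addrA lerD2l exprS.
  have -> : (d m)%:R / (b%:R * b%:R ^+ m) + B%:R / (b%:R - 1) / (b%:R * b%:R ^+ m) =
     ((d m)%:R + B%:R / (b%:R - 1)) / b%:R / b%:R ^+ m :> R.
    by field; rewrite bXn0 !gt_eqF.
  rewrite ler_pM2r ?invr_gt0 // ler_pdivrMr //.
  have -> : B%:R / (b%:R - 1) * b%:R = B%:R + B%:R / (b%:R - 1) :> R.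
    by field; rewrite gt_eqF.
  by rewrite lerD2r ler_nat.
have Tn m : T (n + m)%N <= T n.
  by elim: m => [|m IH]; rewrite ?addn0 // addnS (le_trans (TS _)).
have Sn m : digit_series d n <= digit_series d (n + m)%N.
  rewrite [leRHS](big_cat_nat _ (n := n)) ?leq_addr //= lerDl.
  by apply: sumr_ge0 => j _; rewrite divr_ge0.
apply/andP; split.
  rewrite mulrC -ler_pdivrMr // -digit_seriesE -limE; apply: limr_ge => //.
  by exists n => // m /= /subnKC <-.
suff : x <= T n.
  rewrite /T digit_seriesE -mulrDl ler_pdivlMr // mulrC //.
rewrite -limE; apply: limr_le => //; exists n => // m /= /subnKC <-.
apply: le_trans (Tn (m - n)%N); rewrite /T lerDl.
by rewrite !divr_ge0 // ltW.
Qed.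

Lemma cvg_inv_expb : (fun n => (b%:R ^+ n)^-1 : R) @ \oo --> (0 : R).
Proof.
under eq_fun do rewrite -exprVn.
by apply: cvg_expr; rewrite ger0_norm ?invr_ge0 ?ler0n // invf_lt1 // ltr1n.
Qed.

(** The upper bound is not strict, so that expansions ending in digits [b-1] are covered; the point
    1 needs one. *)
Lemma digit_series_cvg d x :
  (forall n, (digit_prefix b d n)%:R <= b%:R ^+ n * x <= (digit_prefix b d n)%:R + 1) ->
  digit_series d @ \oo --> x.
Proof.
move=> dx; apply: (@squeeze_cvgr _ _ _ _ (fun n => x - (b%:R ^+ n)^-1) (fun=> x)).
- near=> n; rewrite digit_seriesE; have /andP[lo hi] := dx n.
  rewrite lerBlDr ler_pdivrMr // [x * _]mulrC lo andbT.
  by rewrite -[X in _ + X]mul1r -mulrDl ler_pdivlMr // mulrC.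
- rewrite -[X in _ --> X]subr0; apply: cvgB; first exact: cvg_cst.
  exact: cvg_inv_expb.
- exact: cvg_cst.
Unshelve. all: by end_near.
Qed.

Lemma digit_prefix_lt d n : (forall j, d j < b)%N -> (digit_prefix b d n < b ^ n)%N.
Proof.
move=> db; elim: n => //= n IH; rewrite expnS.
apply: leq_trans (_ : b * (digit_prefix b d n).+1 <= _)%N; last by rewrite leq_mul2l IH orbT.
by rewrite mulnS addnC ltn_add2r.
Qed.

Lemma digit_series_is_cvg d : (forall j, d j < b)%N ->
  exists x : R, digit_series d @ \oo --> x.
Proof.
move=> db; exists (sup (range (digit_series d))); apply: nondecreasing_cvgn.
  apply/nondecreasing_seqP => n; rewrite big_nat_recr //= lerDl.
  by rewrite divr_ge0 // ltW.
exists 1 => _ [n _ <-]; rewrite digit_seriesE ler_pdivrMr // mul1r -natrX ler_nat.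
by rewrite ltnW // digit_prefix_lt.
Qed.

Definition greedy_digit y (j : nat) : nat := (Num.truncn (b%:R ^+ j.+1 * y) %% b)%N.

(** This rests on [floor(floor(b z) / b) = floor z]. *)
Lemma digit_prefix_greedy y n : 0 <= y < 1 ->
  digit_prefix b (greedy_digit y) n = Num.truncn (b%:R ^+ n * y).
Proof.
move=> /andP[y0 y1]; elim: n => [|n IH] /=.
  by rewrite expr0 mul1r; apply/esym/truncn_def; rewrite y0 y1.
have ge0 m : 0 <= b%:R ^+ m * y by rewrite mulr_ge0 // ltW.
rewrite IH /greedy_digit; set u := Num.truncn (b%:R ^+ n.+1 * y).
rewrite [RHS](divn_eq u b) mulnC; congr (_ * _ + _)%N; apply: truncn_def.
have /andP[lo hi] := truncn_itv (ge0 n.+1).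
have b0N : (0 < b)%N by exact: ltnW.
have -> : b%:R ^+ n * y = b%:R ^+ n.+1 * y / b%:R.
  by rewrite exprS; field; rewrite gt_eqF.
rewrite ler_pdivlMr // ltr_pdivrMr // -!natrM; apply/andP; split.
  by apply: le_trans lo; rewrite ler_nat leq_trunc_div.
by apply: lt_le_trans hi _; rewrite ler_nat ltn_ceil.
Qed.

Lemma greedy_digit_cvg y : 0 <= y < 1 -> digit_series (greedy_digit y) @ \oo --> y.
Proof.
move=> y01; apply: digit_series_cvg => n; rewrite digit_prefix_greedy //.
have /andP[y0 _] := y01.
have /andP[-> /ltW] : (Num.truncn (b%:R ^+ n * y))%:R <= b%:R ^+ n * y <
    (Num.truncn (b%:R ^+ n * y)).+1%:R by rewrite truncn_itv // mulr_ge0 // ltW.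
by rewrite -natr1.
Qed.

Lemma digit_expansion y : 0 <= y <= 1 ->
  exists2 d, (forall j, d j < b)%N & digit_series d @ \oo --> y.
Proof.
move=> /andP[y0]; rewrite le_eqVlt => /predU1P[->|y1].
  (* The greedy digits require [y < 1]; at 1 all digits are [b-1]. *)
  exists (fun=> b.-1); first by move=> j; rewrite prednK // ltnW.
  apply: digit_series_cvg => n; rewrite mulr1 -natrX.
  have <- : ((digit_prefix b (fun=> b.-1) n).+1 = b ^ n)%N.
    by elim: n => //= n IH; rewrite expnS -IH; lia.
  by rewrite -natr1 lexx lerDl ler01.
exists (greedy_digit y); first by move=> j; rewrite ltn_mod ltnW.
by apply: greedy_digit_cvg; rewrite y0.
Qed.

End Digits.

Lemma digit_prefix_inj b (d d' : nat -> nat) n :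
  (forall j, d j < b)%N -> (forall j, d' j < b)%N ->
  digit_prefix b d n = digit_prefix b d' n -> forall j, (j < n)%N -> d j = d' j.
Proof.
move=> db db'; elim: n => //= n IH e.
have b0 : (0 < b)%N by apply: leq_ltn_trans (db 0).
have en : d n = d' n.
  have := congr1 (fun z => z %% b)%N e => /=.
  by rewrite ![(b * _)%N]mulnC !modnMDl !modn_small.
move: e => /eqP; rewrite en eqn_add2r eqn_mul2l eqn0Ngt b0 /= => /eqP/IH eqd j.
by rewrite ltnS leq_eqVlt => /predU1P[->//|/eqd].
Qed.

Lemma eq_digit_prefix b (d d' : nat -> nat) n :
  (forall j, (j < n)%N -> d j = d' j) -> digit_prefix b d n = digit_prefix b d' n.
Proof.
elim: n => //= n IH e; rewrite IH ?e // => j jn.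
by rewrite e // ltnW.
Qed.

(** * Diameters and covering costs *)

Section EuclideanDiameter.
Variables (R : realType) (k : nat).
Implicit Types (x y : 'I_k -> R) (U : set ('I_k -> R)).

Lemma coord_le_edist x y i : `|x i - y i| <= Defs.edist x y.
Proof.
rewrite -sqrtr_sqr /Defs.edist ler_sqrt ?sumr_ge0 // => [|j _]; last exact: sqr_ge0.
by rewrite (bigD1 i) //= lerDl sumr_ge0 // => j _; exact: sqr_ge0.
Qed.

Lemma edist_le_diam U x y : U x -> U y -> ((Defs.edist x y)%:E <= diam U)%E.
Proof. by move=> Ux Uy; apply: ereal_sup_ubound; exists x => //; exists y. Qed.

Lemma diam_ge0 U : U !=set0 -> (0 <= diam U)%E.
Proof.
move=> [x Ux]; apply: le_trans (edist_le_diam Ux Ux).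
by rewrite lee_fin sqrtr_ge0.
Qed.

Lemma cover_cost_ge0 s U : (0 <= cover_cost s U)%E.
Proof. by rewrite /cover_cost; case: pselect => ? /=; rewrite lee_fin ?powR_ge0. Qed.

End EuclideanDiameter.

(** * Lower bound for the Hausdorff dimension *)

Section HausdorffDimension.
Variables (R : realType) (k b : nat) (D : {set {ffun 'I_k -> 'I_b}}).
Hypotheses (b1 : (1 < b)%N) (M1 : (1 < #|D|)%N).

Local Notation M := #|D|.

Let greedy_lt (y : R) j : (greedy_digit M y j < M)%N.
Proof. by rewrite ltn_mod ltnW. Qed.

(* Reading the base [#|D|] digits of [y] as elements of [D] parametrizes the
   missing-digit set by the unit interval. *)
Definition coding (y : R) (j : nat) : {ffun 'I_k -> 'I_b} :=
  enum_val (Ordinal (greedy_lt y j)).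

Local Notation prefix y n i := (digit_prefix b (fun j => coding y j i : nat) n).

(** Equal prefixes in all coordinates force equal digit vectors, hence, [enum_val] being injective,
    equal base-[M] digits. *)
Lemma coding_prefix_inj (y y' : R) n : 0 <= y < 1 -> 0 <= y' < 1 ->
  (forall i, prefix y n i = prefix y' n i) ->
  Num.truncn (M%:R ^+ n * y) = Num.truncn (M%:R ^+ n * y').
Proof.
move=> y01 y01' e; rewrite -!digit_prefix_greedy //.
apply: eq_digit_prefix => j jn.
have ec : coding y j = coding y' j.
  apply/ffunP => i; apply: val_inj.
  by apply: (digit_prefix_inj _ _ (e i)) => // ?; exact: ltn_ord.
by move: ec => /enum_val_inj/(congr1 val).
Qed.

Lemma coding_point : exists psi : R -> 'I_k -> R,
  (forall y, missing_digit_set D (psi y)) /\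
  forall y n i, (prefix y n i)%:R <= b%:R ^+ n * psi y i <= (prefix y n i)%:R + 1.
Proof.
have ex y : exists x : 'I_k -> R, forall i,
    (fun n => \sum_(0 <= j < n) ((coding y j i : nat)%:R / b%:R ^+ j.+1 : R)) @ \oo --> x i.
  have exi i : exists x : R, (fun n => \sum_(0 <= j < n)
      ((coding y j i : nat)%:R / b%:R ^+ j.+1 : R)) @ \oo --> x.
    by apply: digit_series_is_cvg => // j; exact: ltn_ord.
  by have [x xP] := choice exi; exists x.
have [psi psiP] := choice ex; exists psi; split=> [y|y n i].
  by exists (coding y); split=> // j; exact: enum_valP.
have e1 : b.-1%:R / (b%:R - 1) = 1 :> R.
  by rewrite -subn1 natrB ?divff ?(ltnW b1) // subr_eq0 pnatr_eq1 gtn_eqF.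
rewrite -[X in _ <= _ + X]e1; apply: (digit_prefix_bounds b1 n _ (psiP y i)) => j.
by rewrite -ltnS prednK ?ltn_ord // ltnW.
Qed.

Variable psi : R -> 'I_k -> R.
Hypothesis psiP : forall y n i,
  (prefix y n i)%:R <= b%:R ^+ n * psi y i <= (prefix y n i)%:R + 1.

(* Two points at distance at most [b^-n] have n-digit prefixes differing by at
   most 2 in each coordinate, hence 5 possible differences. *)
Local Notation N5 := #|{ffun 'I_k -> 'I_5}|.

(** Fix [y0] with [psi y0] in [U]. The offsets of the prefixes of [y] from those of [y0] determine
    the prefixes of [y], hence the [M]-adic interval of level [n] containing [y]. *)
Lemma coding_cover (U : set ('I_k -> R)) n :
  (forall x x', U x -> U x' -> forall i, `|x i - x' i| <= b%:R ^- n) ->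
  exists p : nat -> nat, forall y, 0 <= y < 1 -> U (psi y) ->
    exists2 v, (v < N5)%N & Num.truncn (M%:R ^+ n * y) = p v.
Proof.
move=> Un.
have [[y0 [y001 Uy0]]|noy] := pselect (exists y, 0 <= y < 1 /\ U (psi y)); last first.
  by exists id => y y01 Uy; exfalso; apply: noy; exists y.
(* The offset is shifted by 2 to be natural. [S f] has at most one element, and [xget] returns it,
   or 0 if there is none. *)
pose S (f : {ffun 'I_k -> 'I_5}) := [set t | exists y, [/\ 0 <= y < 1,
  (forall i, prefix y n i + 2 = prefix y0 n i + f i)%N &
  t = Num.truncn (M%:R ^+ n * y)]].
exists (fun v => nth 0%N [seq xget 0%N (S f) | f <- enum {: {ffun 'I_k -> 'I_5}}] v).
move=> y y01 Uy.
have close i : (prefix y0 n i <= prefix y n i + 2)%N /\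
               (prefix y n i + 2 < prefix y0 n i + 5)%N.
  have /andP[l0 h0] := psiP y0 n i; have /andP[l h] := psiP y n i.
  have bX0 : 0 < b%:R ^+ n :> R by rewrite exprn_gt0 // ltr0n ltnW.
  have : `|b%:R ^+ n * psi y i - b%:R ^+ n * psi y0 i| <= 1.
    rewrite -mulrBr normrM gtr0_norm // mulrC -ler_pdivlMr // mul1r.
    exact: Un.
  rewrite ler_norml => /andP[c1 c2]; split; rewrite -?(ltr_nat R) -?(ler_nat R) !natrD; lra.
have lt5 i : (prefix y n i + 2 - prefix y0 n i < 5)%N by have [] := close i; lia.
pose f := [ffun i => Ordinal (lt5 i)].
have fE i : (prefix y n i + 2 = prefix y0 n i + f i)%N.
  by rewrite ffunE /= subnKC //; have [] := close i.
exists (index f (enum {: {ffun 'I_k -> 'I_5}})).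
  by rewrite cardE index_mem mem_enum.
rewrite (nth_map f) ?index_mem ?mem_enum // nth_index ?mem_enum //.
have /(xgetI 0%N) [y' [y01' e ->]] : S f (Num.truncn (M%:R ^+ n * y)) by exists y.
apply: coding_prefix_inj => // i; apply/eqP.
by rewrite -(eqn_add2r 2) fE e.
Qed.

(** The preimage of [F i] under [psi] is not known to be measurable; it is enlarged to the union
    [G i] of at most [N5] closed intervals of length [M^-n], and subadditivity is applied to
    these. *)
Lemma unit_interval_cover (F : nat -> set ('I_k -> R)) (n : nat -> nat) :
  missing_digit_set D `<=` \bigcup_i F i -> (forall y, missing_digit_set D (psi y)) ->
  (forall i x x', F i x -> F i x' -> forall l, `|x l - x' l| <= b%:R ^- n i) ->
  (1 <= \sum_(0 <= i <oo) (N5%:R * M%:R ^- n i : R)%:E)%E.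
Proof.
move=> KF psiK Fn.
have [p pP] := choice (fun i => coding_cover (Fn i)).
pose I i v : set R := `[(p i v)%:R / M%:R ^+ n i, (p i v).+1%:R / M%:R ^+ n i]%classic.
pose G i := \big[setU/set0]_(v < N5) I i v.
have MX0 m : 0 < M%:R ^+ m :> R by rewrite exprn_gt0 // ltr0n ltnW.
have mG i : measurable (G i) by apply: bigsetU_measurable => v _; exact: measurable_itv.
have cov : `[0, 1[%classic `<=` \bigcup_i G i.
  move=> y /=; rewrite in_itv /= => y01.
  have [i _ Fi] := KF _ (psiK y).
  have [v vN ep] := pP i y y01 Fi; exists i => //.
  rewrite /G -(bigcup_mkord _ (I i)); exists v => //.
  have /andP[y0 _] := y01.
  have /andP[lo hi] : (Num.truncn (M%:R ^+ n i * y))%:R <= M%:R ^+ n i * y <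
    (Num.truncn (M%:R ^+ n i * y)).+1%:R by rewrite truncn_itv // mulr_ge0 // ltW.
  by rewrite /I /= in_itv /= -ep ler_pdivrMr // ler_pdivlMr // [y * _]mulrC lo ltW.
have l1 : lebesgue_measure (`[0, 1[%classic : set R) = 1%E.
  by rewrite lebesgue_measure_itv /= lte_fin ltr01 oppr0 adde0.
have le1 := measure_sigma_subadditive (@lebesgue_measure R) mG (measurable_itv _) cov.
rewrite -l1; apply: le_trans le1 _.
apply: lee_nneseries => // i _.
have mI v : (v < N5)%N -> measurable (I i v) by move=> _; exact: measurable_itv.
have le2 : (lebesgue_measure (G i) <= \sum_(v < N5) lebesgue_measure (I i v))%E.
  exact: (content_subadditive (@lebesgue_measure R) mI (mG i)).
apply: le_trans le2 _.
have lI v : lebesgue_measure (I i v) = (M%:R ^- n i)%:E.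
  rewrite /I lebesgue_measure_itv /= lte_fin ltr_pM2r ?invr_gt0 // ltr_nat ltnSn.
  by rewrite -EFinB -mulrBl -natr1 [_ + 1]addrC addrK mul1r.
rewrite (eq_bigr (fun=> (M%:R ^- n i)%:E)) => [|v _]; last exact: lI.
by rewrite sumEFin sumr_const card_ord mulr_natl.
Qed.

End HausdorffDimension.

(** For diameter [r > 0], take [n] with [b^-(n+1) < r <= b^-n]; then [M^-n <= (b^-n)^s0 <= (b r)^s0
    <= b^s0 r^s], the last step because [r <= 1]. The slack [e] serves empty sets and sets of
    diameter 0, for which [n] is simply taken large. *)
Lemma exists_small_scale (R : realType) (k b M : nat) (s s0 e : R) (U : set ('I_k -> R)) :
  (1 < b)%N -> (1 < M)%N -> s <= s0 -> 0 <= s0 -> b%:R `^ s0 <= M%:R -> 0 < e ->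
  (diam U <= 1%:E)%E ->
  exists n, (forall x x', U x -> U x' -> forall i, `|x i - x' i| <= b%:R ^- n) /\
    ((M%:R ^- n)%:E <= (b%:R `^ s0)%:E * cover_cost s U + e%:E)%E.
Proof.
move=> b1 M1 ss0 s00 bM e0 U1.
have b0 : 0 < b%:R :> R by rewrite ltr0n ltnW.
have bs0 : 0 <= b%:R `^ s0 :> R := powR_ge0 _ _.
have small (c : nat) (d : R) : (1 < c)%N -> 0 < d -> exists n, c%:R ^- n < d.
  move=> c1 d0; have := @cvgr_lt _ _ _ _ _ _ (@cvg_inv_expb R c c1) d d0.
  by move=> [n _ /(_ n (leqnn n))]; exists n.
rewrite /cover_cost; case: pselect => [UE|UN] /=.
  have [n nlt] := small M e M1 e0; exists n; split=> [x x'|]; first by rewrite UE.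
  by rewrite mule0 add0e lee_fin ltW.
have /set0P/diam_ge0 U0 : U != set0 by apply/eqP.
have Ufin : diam U \is a fin_num by rewrite ge0_fin_numE // (le_lt_trans U1) // ltry.
set r := fine (diam U).
have rE : diam U = r%:E by rewrite fineK.
have r0 : 0 <= r by rewrite fine_ge0.
have r1 : r <= 1 by rewrite -lee_fin -rE.
have close x x' i : U x -> U x' -> `|x i - x' i| <= r.
  move=> Ux Ux'; apply: le_trans (coord_le_edist x x' i) _.
  by rewrite -lee_fin -rE; exact: edist_le_diam.
move: r0; rewrite le_eqVlt => /predU1P[r00|r0].
  have [n nlt] := small M e M1 e0; exists n; split=> [x x' Ux Ux' i|].
    by apply: le_trans (close _ _ _ Ux Ux') _; rewrite -r00 invr_ge0 exprn_ge0 // ltW.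
  rewrite -EFinM -EFinD lee_fin; apply: le_trans (ltW nlt) _.
  by rewrite lerDr mulr_ge0 // powR_ge0.
have exn : exists n, b%:R ^- n.+1 < r.
  have [n nlt] := small b r b1 r0; exists n; apply: le_lt_trans nlt.
  by rewrite lef_pV2 ?posrE ?exprn_gt0 // ler_weXn2l // ler1n ltnW.
have [n nr nmin] := ex_minnP exn.
have rn : r <= b%:R ^- n.
  case: n nmin {nr} => [|n] nmin; first by rewrite expr0 invr1.
  by rewrite leNgt; apply/negP => /nmin; rewrite ltnn.
exists n; split=> [x x' Ux Ux' i|]; first exact: le_trans (close _ _ _ Ux Ux') rn.
rewrite -EFinM -EFinD lee_fin ler_wpDr ?(ltW e0) //.
have bXs m : (b%:R ^- m) `^ s0 = (b%:R `^ s0) ^- m :> R.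
  by rewrite -[b%:R ^- m]powR_invn ?(ltW b0) // -powRrM mulrC powRrM powR_invn.
have br : b%:R ^- n <= b%:R * r.
  by rewrite mulrC -ler_pdivrMr // -invfM -exprSr ltW.
apply: le_trans (_ : (b%:R * r) `^ s0 <= _).
  apply: le_trans (_ : (b%:R ^- n) `^ s0 <= _).
    rewrite bXs lef_pV2 ?posrE ?exprn_gt0 ?powR_gt0 // ?ltr0n ?(ltnW M1) //.
    by rewrite lerXn2r ?nnegrE.
  by rewrite ge0_ler_powR // nnegrE ?invr_ge0 ?exprn_ge0 ?mulr_ge0 // ltW.
rewrite powRM ?(ltW b0) ?(ltW r0) // ler_wpM2l //.
by rewrite ger_powR // r0.
Qed.

(** If the [s]-measure vanished for some [s < s0], there would be a cover of cost below [1/(4A)];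
    transported to [0,1) it would have total length at most [1/4 + 1/2 < 1]. *)
Lemma hausdorff_dim_missing_digit_ge (R : realType) (k b : nat)
    (D : {set {ffun 'I_k -> 'I_b}}) (s0 : R) : (1 < b)%N ->
  b%:R `^ s0 <= #|D|%:R ->
  (s0%:E <= hausdorff_dim (@missing_digit_set R k b D))%E.
Proof.
move=> b1 bD; apply: le_ereal_inf_tmp => _ [s [s_ge0 Hs] <-].
rewrite lee_fin leNgt; apply/negP => ss0.
have s00 : 0 < s0 by apply: le_lt_trans ss0.
have M1 : (1 < #|D|)%N.
  rewrite -(ltr_nat R); apply: lt_le_trans bD.
  by rewrite -[ltLHS](congr1 (@^~ s0) (powR1 R)) gt0_ltr_powR ?nnegrE ?ltr1n.
have [psi [psiK psiP]] := coding_point R b1 M1.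
set N5 := #|{ffun 'I_k -> 'I_5}|.
have N50 : 0 < N5%:R :> R by rewrite ltr0n /N5 card_ffun !card_ord expn_gt0.
pose A : R := N5%:R * b%:R `^ s0.
have A0 : 0 < A by rewrite mulr_gt0 // powR_gt0 // ltr0n ltnW.
have : (hausdorff_delta s 1 (@missing_digit_set R k b D) < ((4 * A)^-1)%:E)%E.
  apply: (@le_lt_trans _ _ 0%E); last by rewrite lte_fin invr_gt0 mulr_gt0.
  by rewrite -Hs; apply: ereal_sup_ubound; exists 1 => //=.
move=> /ereal_inf_lt[_ [F [KF F1] <-] Flt].
(* These slacks, multiplied by [N5], sum to 1/2. *)
pose e i : R := (2^-1 / (2 ^ i.+1)%:R) / N5%:R.
have e0 i : 0 < e i by rewrite !divr_gt0 // ltr0n expn_gt0.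
have [n nP] := choice (fun i => exists_small_scale b1 M1 (ltW ss0) (ltW s00) bD (e0 i) (F1 i)).
have := @unit_interval_cover R k b D b1 M1 psi psiP F n KF psiK (fun i => (nP i).1).
apply/negP; rewrite -ltNge.
apply: (@le_lt_trans _ _ (\sum_(0 <= i <oo) (A%:E * cover_cost s (F i) + (2^-1 / (2 ^ i.+1)%:R)%:E)))%E.
  apply: lee_nneseries => [i _ _|i _]; first by rewrite lee_fin mulr_ge0 // invr_ge0 exprn_ge0.
  have [_ le1] := nP i.
  have -> : (A%:E * cover_cost s (F i) + (2^-1 / (2 ^ i.+1)%:R)%:E)%E =
      (N5%:R%:E * ((b%:R `^ s0)%:E * cover_cost s (F i) + (e i)%:E))%E.
    rewrite ge0_muleDr ?mule_ge0 ?lee_fin ?powR_ge0 ?cover_cost_ge0 ?(ltW (e0 i)) //.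
    rewrite muleA -!EFinM; congr (_ + _%:E)%E.
    by rewrite /e [RHS]mulrC divfK // gt_eqF.
  by rewrite EFinM lee_pmul2l ?lte_fin.
apply: le_lt_trans (epsilon_trick _ _ _) _ => [i||].
- by rewrite mule_ge0 ?cover_cost_ge0 // lee_fin ltW.
- by rewrite invr_ge0.
rewrite nneseriesZl => [|i _]; last exact: cover_cost_ge0.
apply: (@le_lt_trans _ _ (4^-1 + 2^-1)%:E); last by rewrite lte_fin; lra.
rewrite EFinD leeD2r // -lee_pdivlMl //.
by rewrite -EFinM -invfM mulrC ltW // mulrC.
Qed.

(** * The fractal and its rational points *)

Lemma card_ffun_last (T : finType) (k : nat) (S : {set T}) :
  #|[set f : {ffun 'I_k.+1 -> T} | f ord_max \in S]%SET| = (#|S| * #|T| ^ k)%N.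
Proof.
pose F (i : 'I_k.+1) : pred T := fun x => (i == ord_max) ==> (x \in S).
have -> : #|[set f : {ffun 'I_k.+1 -> T} | f ord_max \in S]%SET| =
    #|(family F : simpl_pred {ffun 'I_k.+1 -> T})|.
  apply: eq_card => f; rewrite finset.in_set; apply/idP/familyP => [fS i|/(_ ord_max)].
    by rewrite unfold_in /F; apply/implyP => /eqP ->.
  by rewrite /F unfold_in eqxx.
rewrite card_family foldrE big_map big_enum (bigD1 ord_max) //=.
congr (_ * _)%N; first by apply: eq_card => x; rewrite unfold_in /F eqxx.
rewrite (eq_bigr (fun=> #|T|)) => [|i /negbTE ni]; last first.
  by apply: eq_card => x; rewrite unfold_in /F ni.
rewrite prod_nat_const; congr (_ ^ _)%N.
by rewrite cardC1 card_ord.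
Qed.

Definition last_digit_lt (k b N : nat) : {set {ffun 'I_k.+1 -> 'I_b}} :=
  [set f : {ffun 'I_k.+1 -> 'I_b} | f ord_max \in [set d : 'I_b | (d < N)%N]]%SET.

Lemma card_last_digit_lt k b N : (N <= b)%N ->
  #|last_digit_lt k b N| = (N * b ^ k)%N.
Proof.
move=> Nb; rewrite card_ffun_last card_ord; congr (_ * _)%N.
rewrite cardsE -sum1_card -[RHS](card_ord N) -sum1_card.
by rewrite (big_ord_widen _ (fun=> 1%N) Nb).
Qed.

Section LastDigit.
Variables (R : realType) (k b N : nat).
Hypotheses (b1 : (1 < b)%N) (N0 : (0 < N)%N) (Nb : (N < b)%N).

Local Notation K := (@missing_digit_set R k.+1 b (last_digit_lt k b N)).

Lemma face0_sub_last_digit_lt : @face0 R k.+1 `<=` K.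
Proof.
move=> x fx.
have ex (i : 'I_k.+1) : exists d : nat -> 'I_b, (i = ord_max -> forall j, d j < N)%N /\
    (fun n => \sum_(0 <= j < n) ((d j : nat)%:R / b%:R ^+ j.+1 : R)) @ \oo --> x i.
  have := fx i; rewrite /=; have [->|ni] := eqVneq i ord_max.
    rewrite eqxx => ->; exists (fun=> Ordinal (ltnW b1)); split=> //.
    under eq_fun do (rewrite big1 ?mul0r //; last by move=> *; rewrite mul0r).
    exact: cvg_cst.
  rewrite [(_ == _)%N](negbTE ni) => xi.
  have [d db dx] := digit_expansion b1 xi.
  by exists (fun j => Ordinal (db j)); split=> // e; rewrite e eqxx in ni.
have [d dP] := choice ex.
exists (fun j => [ffun i => d i j]); split=> [j|i].
  by rewrite !inE ffunE; have [+ _] := dP ord_max; exact.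
have [_ dx] := dP i; under eq_fun do under eq_bigr do rewrite ffunE.
exact: dx.
Qed.

Lemma last_digit_lt_itv (x : 'I_k.+1 -> R) i : K x -> 0 <= x i <= 1.
Proof.
move=> [d [_ dx]].
have dB j : (d j i <= b.-1)%N by rewrite -ltnS prednK ?ltn_ord // ltnW.
have := digit_prefix_bounds b1 0 dB (dx i); rewrite /= expr0 mul1r add0r.
by rewrite -subn1 natrB ?(ltnW b1) // divff // subr_eq0 pnatr_eq1 gtn_eqF.
Qed.

Let itv_last (x : 'I_k.+1 -> R) j : K x -> exists z : nat,
  z%:R <= b%:R ^+ j * x ord_max <= z%:R + N.-1%:R / (b%:R - 1).
Proof.
move=> [d [dD dx]].
have dB i : (d i ord_max <= N.-1)%N.
  by have := dD i; rewrite !inE; lia.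
by exists (digit_prefix b (fun i => d i ord_max) j); exact: (digit_prefix_bounds b1 j dB).
Qed.

Let bm1 : 0 < b%:R - 1 :> R. Proof. by rewrite subr_gt0 ltr1n. Qed.

(** The bound is [(N-1)/(b-1) < 1]. It makes the last numerator a residue [a < q], as
    [narrow_fractions] requires. *)
Lemma last_digit_lt_lt1 (x : 'I_k.+1 -> R) : K x -> x ord_max < 1.
Proof.
move=> Kx; have [d [dD dx]] := Kx.
have dB i : (d i ord_max <= N.-1)%N by have := dD i; rewrite !inE; lia.
have /andP[_] := digit_prefix_bounds b1 0 dB (dx ord_max).
rewrite /= expr0 mul1r add0r => /le_lt_trans; apply.
rewrite ltr_pdivrMr // mul1r ltrBrDr natr1 prednK // ltr_nat //.
Qed.

(** The tail bound [(N-1)/(b-1)] is at most [1/(8H)], since [8H (N-1) <= 8HN - 1 = b - 1]. *)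
Lemma last_digit_lt_narrow H (x : 'I_k.+1 -> R) :
  (0 < H)%N -> b = (8 * H * N)%N -> K x -> narrow b H (x ord_max).
Proof.
move=> H0 bE Kx j; have [z /andP[lo hi]] := itv_last j Kx.
exists z; rewrite lo /=; apply: le_trans hi _; rewrite lerD2l ler_pdivrMr //.
have -> : N.-1%:R = N%:R - 1 :> R by rewrite -subn1 natrB.
rewrite ler_pdivlMl ?mulr_gt0 ?ltr0n // bE !natrM.
have : 1 <= H%:R :> R by rewrite ler1n.
by rewrite mulrBr lerD2l lerNl opprK; lra.
Qed.

End LastDigit.

(** The denominator and last numerator form a narrow fraction, and each of the other [k] numerators
    lies between 0 and [n], which leaves at most [n+1] values. *)
Lemma count_rat_points_le (R : realType) (k b N H : nat) (Q : R) :
  (1 < b)%N -> (0 < N)%N -> (N < b)%N -> (0 < H)%N -> b = (8 * H * N)%N -> 1 <= Q ->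
  (count_rat_points (@missing_digit_set R k.+1 b (last_digit_lt k b N)) Q <=
   ((\sum_(1 <= q < (Num.truncn Q).+1) #|narrow_fractions R b H q|)
     * (Num.truncn Q).+1 ^ k)%:R%:E)%E.
Proof.
move=> b1 N0 Nb H0 bE Q1; set n := Num.truncn Q.
have Q0 : 0 <= Q by apply: le_trans Q1.
pose good (q a : nat) := [&& (0 < q)%N, (a < q)%N & `[< narrow b H (a%:R / q%:R : R) >]].
pose S (q : nat) : {set 'I_n.+1} := [set a : 'I_n.+1 | good q a]%SET.
pose B := [set w : 'I_n.+1 * {ffun 'I_k.+1 -> 'I_n.+1} | w.2 ord_max \in S w.1]%SET.
have cardB : (#|B| <= (\sum_(1 <= q < n.+1) #|narrow_fractions R b H q|) * n.+1 ^ k)%N.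
  rewrite cardsE -sum1_card.
  rewrite -(pair_big_dep xpredT (fun (q : 'I_n.+1) (f : {ffun 'I_k.+1 -> 'I_n.+1}) =>
    f ord_max \in S q) (fun _ _ => 1%N)) /=.
  rewrite (eq_bigr (fun q : 'I_n.+1 => #|S q| * n.+1 ^ k)%N) => [|q _]; last first.
    have := card_ffun_last k (S q); rewrite card_ord => <-; exact: sum1dep_card.
  rewrite -big_distrl leq_mul2r; apply/orP; right => /=.
  rewrite -(big_mkord xpredT (fun q => #|S q|)) big_ltn //.
  have -> : #|S 0%N| = 0%N by apply: eq_card0 => a; rewrite !inE.
  rewrite add0n !big_nat; apply: leq_sum => q /andP[q0 qn].
  apply: leq_trans (leq_imset_card (fun a : 'I_q => inord a : 'I_n.+1) _).
  apply: subset_leq_card; apply/fintype.subsetP => a; rewrite inE => /and3P[_ aq na].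
  apply/imsetP; exists (Ordinal aq); first by rewrite inE.
  by rewrite /= inord_val.
pose phi (w : 'I_n.+1 * {ffun 'I_k.+1 -> 'I_n.+1}) : {ffun 'I_k.+1 -> int} * int :=
  ([ffun i => (w.2 i : nat)%:Z], (w.1 : nat)%:Z).
(* The count is a supremum over finite subsets, so each of these is embedded in the image of [B]
   under [phi]. *)
rewrite /count_rat_points /esum; apply: ge_ereal_sup => _ [A [finA AK] <-].
rewrite fsbig_finite //= sumEFin lee_fin big_const_seq count_predT iter_addr_0 ler_nat.
apply: leq_trans cardB; rewrite cardE -(size_map phi).
apply: uniq_leq_size; first exact: finmap.fset_uniq.
move=> [a q]; rewrite in_fset_set // inE => /AK[/= q1 [qQ Ka]].
have [q' qE] : exists q' : nat, q = q'%:Z by exists `|q|%N; lia.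
subst q; have q0 : (0 < q')%N by lia.
have qR : 0 < q'%:R :> R by rewrite ltr0n.
have qn : (q' <= n)%N by rewrite truncn_ge_nat.
have ai i : 0 <= (a i)%:~R / q'%:R <= (1 : R) := last_digit_lt_itv b1 i Ka.
have [a' aE] : exists a' : 'I_k.+1 -> nat, forall i, a i = (a' i)%:Z /\ (a' i <= q')%N.
  have exi i : exists z : nat, a i = z%:Z /\ (z <= q')%N.
    have /andP[] := ai i; rewrite pmulr_lge0 ?invr_gt0 // ler0z => a0.
    rewrite ler_pdivrMr // mul1r -[q'%:R]/(q'%:Z%:~R) ler_int => aq.
    by exists `|a i|%N; split; lia.
  by have [f fP] := choice exi; exists f.
have a'n i : (a' i < n.+1)%N by rewrite ltnS (leq_trans (aE i).2).
apply/mapP; exists (Ordinal (qn : q' < n.+1)%N, [ffun i => Ordinal (a'n i)]); last first.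
  congr (_, _); apply/ffunP => i; rewrite !ffunE /=; exact: (aE i).1.
rewrite mem_enum !inE /= ffunE /good /= q0 /=.
have xE : (a ord_max)%:~R / q'%:R = (a' ord_max)%:R / q'%:R :> R.
  by rewrite (aE ord_max).1.
apply/andP; split.
  have := last_digit_lt_lt1 b1 N0 Nb Ka.
  by rewrite [X in X < 1]xE ltr_pdivrMr // mul1r ltr_nat.
by apply/asboolP; rewrite -xE; exact: (last_digit_lt_narrow b1 N0 Nb H0 bE Ka).
Qed.

(** Take [t]-th roots: the exponent becomes [1 + 2/t <= 1 + eta]. *)
Lemma natr_root_bound (R : realType) (t C x n : nat) (eta : R) :
  (0 < t)%N -> (0 < n)%N -> 2 / t%:R <= eta -> (x ^ t <= C * n ^ (t + 2))%N ->
  x%:R <= C%:R `^ (t%:R^-1) * n%:R `^ (1 + eta) :> R.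
Proof.
move=> t0 n0 teta; rewrite -(ler_nat R) natrM !natrX => le1.
have tR : 0 < t%:R :> R by rewrite ltr0n.
have tn0 : t%:R != 0 :> R by rewrite gt_eqF.
have -> : x%:R = (x%:R ^+ t) `^ (t%:R^-1) :> R.
  by rewrite -powR_mulrn // -powRrM divff // powRr1.
apply: le_trans (_ : (C%:R * n%:R ^+ (t + 2)) `^ (t%:R^-1) <= _).
  by apply: ge0_ler_powR; rewrite ?nnegrE ?invr_ge0 ?mulr_ge0 ?exprn_ge0.
rewrite powRM ?exprn_ge0 // ler_wpM2l ?powR_ge0 //.
rewrite -powR_mulrn // -powRrM ler_powR ?ler1n // natrD mulrDl divff //.
by rewrite lerD2l.
Qed.

Theorem theorem1p15 (R : realType) (k : nat) (eta : R) :
  (1 <= k)%N -> 0 < eta ->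
  exists K : set ('I_k -> R),
    is_missing_digit_fractal K /\
    @face0 R k `<=` K /\
    (exists C : R, 0 < C /\
       forall Q : R, 1 <= Q ->
         (count_rat_points K Q <= (C * Q `^ (k%:R + eta))%:E)%E) /\
    (hausdorff_dim K > (k%:R - eta)%:E)%E.
Proof.
case: k => // k _ eta0.
(* [t] makes the excess [2/t] in the counting exponent at most [eta], with [t > 1] guaranteed; [m]
   makes the dimension deficit [1/m] less than [eta]. *)
pose t := (Num.truncn (2 / eta)).+2; pose m := (Num.truncn eta^-1).+1.
have teta : 2 / t%:R <= eta.
  rewrite ler_pdivrMr ?ltr0n // mulrC -ler_pdivrMr // ltW //.
  by apply: lt_trans (truncnS_gt _) _; rewrite ltr_nat.
have meta : m%:R^-1 < eta.
  by rewrite invf_plt ?posrE ?ltr0n // truncnS_gt.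
set H := (4 ^ t)%N; set b := ((8 * H) ^ m)%N; set N := ((8 * H) ^ m.-1)%N.
have H0 : (0 < H)%N by rewrite expn_gt0.
have bE : b = (8 * H * N)%N by rewrite /b /N -expnS.
have N0 : (0 < N)%N by rewrite expn_gt0 muln_gt0 H0.
have Nb : (N < b)%N by rewrite bE ltn_Pmull //; lia.
have b1 : (1 < b)%N by apply: leq_ltn_trans Nb.
exists (@missing_digit_set R k.+1 b (last_digit_lt k b N)); split.
  exists b, (last_digit_lt k b N); split=> //; split=> //.
  by rewrite -card_gt0 card_last_digit_lt ?(ltnW Nb) // muln_gt0 N0 expn_gt0 (ltnW b1).
split; first exact: face0_sub_last_digit_lt.
split.
  have [C HC] := @sum_card_narrow_fractions_pow R t m isT isT.
  (* The factor [2^k] comes from [n + 1 <= 2 Q] in the free coordinates, and [C.+1] ensures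
     positivity. *)
  exists (2 ^+ k * C.+1%:R `^ (t%:R^-1)); split.
    by rewrite mulr_gt0 ?exprn_gt0 ?powR_gt0.
  move=> Q Q1; apply: le_trans (count_rat_points_le k b1 N0 Nb H0 bE Q1) _.
  have n0 : (0 < Num.truncn Q)%N by rewrite truncn_gt0.
  have nQ : (Num.truncn Q)%:R <= Q by rewrite truncn_le (le_trans _ Q1).
  move: (Num.truncn Q) n0 nQ (HC _ n0) => n n0 nQ HCn.
  have {HCn}sum_le := natr_root_bound (isT : 0 < t)%N n0 teta (leq_trans HCn (leq_mul (leqnSn C) (leqnn _))).
  have Q0 : 0 < Q by apply: lt_le_trans Q1.
  rewrite lee_fin natrM mulrC natrX.
  apply: le_trans (ler_pM _ _ (_ : _ <= (2 * Q) ^+ k) sum_le) _; rewrite ?exprn_ge0 //.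
    rewrite lerXn2r ?nnegrE ?mulr_ge0 ?(ltW Q0) //.
    by apply: le_trans (_ : 2 * n%:R <= _); rewrite ?ler_pM2l // -natrM ler_nat; lia.
  rewrite exprMn [2 ^+ k * Q ^+ k * _]mulrACA ler_pM2l; last first.
    by rewrite mulr_gt0 ?exprn_gt0 ?powR_gt0.
  have -> : k.+1%:R + eta = k%:R + (1 + eta) by rewrite -natr1; ring.
  rewrite [Q `^ _]powRD; last by rewrite (gt_eqF Q0) implybT.
  rewrite powR_mulrn ?(ltW Q0) // ler_wpM2l ?exprn_ge0 ?(ltW Q0) //.
  by apply: ge0_ler_powR; rewrite ?nnegrE ?addr_ge0 ?(ltW Q0) ?(ltW eta0).
apply: (@lt_le_trans _ _ (k.+1%:R - m%:R^-1)%:E).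
  by rewrite lte_fin ltrD2l ltrN2.
(* Since [N = b^(1 - 1/m)], the digit set has exactly [b^(k + 1 - 1/m)] elements. *)
apply: hausdorff_dim_missing_digit_ge => //.
rewrite card_last_digit_lt ?(ltnW Nb) // /b /N.
set c := (8 * H)%N.
have -> : (c ^ m)%:R `^ (k.+1%:R - m%:R^-1) = (c%:R `^ (m%:R * (k.+1%:R - m%:R^-1))) :> R.
  by rewrite powRrM powR_mulrn // natrX.
have -> : m%:R * (k.+1%:R - m%:R^-1) = (m.-1 + m * k)%:R :> R.
  rewrite mulrBr divff ?pnatr_eq0 // natrD natrM -[m in LHS]prednK //.
  by rewrite -!natr1 /=; ring.
by rewrite powR_mulrn // exprD exprM natrM !natrX.
Qed.
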